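(* Let $M$ be a continuous local martingale vanishing at $0$, with quadratic variation $\langle M,M\rangle$, let $N_m$ ($m\ge0$) be its discrete quadratic variation processes and $B_m$ ($m\ge0$) the sequence of shrunken random walks embedded into $M$. (i) For every fixed $K>0$ and every sequence $(c_m)$ increasing to $\infty$ (arbitrarily slowly), \[ \sup_{0\le t\le K}\left|M(t)-B_m(N_m(t))\right|<c_m\,m\,2^{-m/2}\qquad\text{a.s.}\quad(m\to\infty). \] (ii) There is a positive integer $m_5$ (an absolute constant) such that the following holds. Suppose that there is a finite valued function $g$ with $g(t)\ge\max\{t,e\}$ such that for each $t>0$ the quadratic variation satisfies $\langle M,M\rangle_t\le g(t)$ almost surely. Then for any $m\ge m_5$, \[ \sup_{0\le t\le K}\left|M(t)-B_m(N_m(t))\right|<g(K)^{1/4}(\log g(K))^{3/4}\qquad\text{a.s.}\quad(K\to\infty). \]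
   Context: $M=(M(t),t\ge0)$ is adapted to a filtration $(\mathcal F_t)_{t\ge0}$ on a probability space $(\Omega,\mathcal F,\mathbf P)$. Its quadratic variation $\langle M,M\rangle_t$ has a.s. continuous non-decreasing paths vanishing at $0$; $T_s=\inf\{t:\langle M,M\rangle_t>s\}$, with $\inf\emptyset=\infty$. DDS Wiener process of $M$ (Dambis, Dubins–Schwarz): if $\langle M,M\rangle_\infty=\infty$ a.s., $W(s)=M(T_s)$. If $\langle M,M\rangle_\infty<\infty$ with positive probability, the probability space is enlarged to carry a Wiener process $\widetilde\beta$ independent of $M$, and $W(s)=M(T_s)$ for $s<\langle M,M\rangle_\infty$, $W(s)=M(\infty)+\widetilde\beta(s-\langle M,M\rangle_\infty)$ for $s\ge\langle M,M\rangle_\infty$, where $M(\infty)=\lim_{t\to\infty}M(t)$ exists a.s. on $\{\langle M,M\rangle_\infty<\infty\}$. Then $W$ is a standard Brownian motion and $M(t)=W(\langle M,M\rangle_t)$ for $t\ge 0$. Shrunken random walks embedded into $M$: $s_m(0)=0$, $s_m(k+1)=\inf\{s:s>s_m(k),\ |W(s)-W(s_m(k))|=2^{-m}\}$ $(k\ge0)$; $B_m(k2^{-2m})=W(s_m(k))$ for integers $k\ge0$, and $B_m(t)$ is defined for all real $t\ge0$ by pathwise linear interpolation between these points. Discrete quadratic variation: $\tau_m(0)=0$, $\tau_m(k+1)=\inf\{t:t>\tau_m(k),\ |M(t)-M(\tau_m(k))|=2^{-m}\}$ $(k\ge0)$, and $N_m(t)=2^{-2m}\,\#\{r:\ r>0,\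 \tau_m(r)\le t\}=2^{-2m}\,\#\{r:\ r>0,\ s_m(r)\le\langle M,M\rangle_t\}$, $t\ge0$ ($r$ integer). An inequality followed by ''a.s. $(m\to\infty)$'' (resp. ''a.s. $(K\to\infty)$'') means that, almost surely, it holds for all sufficiently large $m$ (resp. all sufficiently large $K$), where the threshold may depend on $\omega$. *)

(* Defs.v *)
From HB Require Import structures.
From mathcomp Require Import all_boot all_order all_algebra archimedean finmap.
From mathcomp Require Import all_classical all_reals all_analysis.

Set Implicit Arguments.
Unset Strict Implicit.
Unset Printing Implicit Defensive.

Import Order.TTheory GRing.Theory Num.Theory.
Import numFieldNormedType.Exports.

Local Open Scope classical_set_scope.
Local Open Scope ring_scope.

(* A process indexed by [0, +oo[ is a function X : R -> T -> R whose values at *)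
(* negative times are irrelevant.                                              *)

Definition filtration d (T : measurableType d) (R : realType)
    (F : R -> set_system T) : Prop :=
  [/\ forall t, 0 <= t -> sigma_algebra [set: T] (F t),
      forall t, 0 <= t -> F t `<=` measurable &
      forall s t, 0 <= s -> s <= t -> F s `<=` F t].

Definition measurable_wrt (T : Type) (R : realType) (G : set_system T)
    (X : T -> R) : Prop :=
  forall B : set R, measurable B -> G (X @^-1` B).

Definition adapted (T : Type) (R : realType) (F : R -> set_system T)
    (X : R -> T -> R) : Prop :=
  forall t, 0 <= t -> measurable_wrt (F t) (X t).

(* Y is a version of the conditional expectation of X given G. *)
Definition is_cond_exp d (T : measurableType d) (R : realType)
    (P : probability T R) (G : set_system T) (X Y : T -> R) : Prop :=
  [/\ measurable_wrt G Y,
      P.-integrable [set: T] (EFin \o Y) &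
      forall A, G A ->
        (\int[P]_(w in A) (Y w)%:E = \int[P]_(w in A) (X w)%:E)%E].

Definition martingale d (T : measurableType d) (R : realType)
    (P : probability T R) (F : R -> set_system T) (X : R -> T -> R) : Prop :=
  [/\ adapted F X,
      forall t, 0 <= t -> P.-integrable [set: T] (EFin \o X t) &
      forall s t, 0 <= s -> s <= t -> is_cond_exp P (F s) (X t) (X s)].

Definition stopping_time (T : Type) (R : realType) (F : R -> set_system T)
    (S : T -> \bar R) : Prop :=
  (forall w, 0 <= S w)%E /\
  forall t : R, 0 <= t -> F t [set w | (S w <= t%:E)%E].

Definition stopped (T : Type) (R : realType) (X : R -> T -> R)
    (S : T -> \bar R) : R -> T -> R :=
  fun t w => X (fine (Order.min t%:E (S w))) w.

(* The initial value is not subtracted from the stopped process: the notion is *)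
(* only used for processes that vanish at 0.                                   *)
Definition local_martingale d (T : measurableType d) (R : realType)
    (P : probability T R) (F : R -> set_system T) (X : R -> T -> R) : Prop :=
  adapted F X /\
  exists S : nat -> T -> \bar R,
    [/\ forall n, stopping_time F (S n),
        {ae P, forall w, forall n, (S n w <= S n.+1 w)%E},
        {ae P, forall w, S n w @[n --> \oo] --> +oo%E} &
        forall n, martingale P F (stopped X (S n))].

Definition continuous_paths d (T : measurableType d) (R : realType)
    (P : probability T R) (X : R -> T -> R) : Prop :=
  {ae P, forall w, {within `[0, +oo[%classic, continuous (X ^~ w)}}.

Definition vanishes_at_0 d (T : measurableType d) (R : realType)
    (P : probability T R) (X : R -> T -> R) : Prop :=
  {ae P, forall w, X 0 w = 0}.

(* A is the process <M,M>, for a continuous local martingale M vanishing at 0. *)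
Definition quadratic_variation d (T : measurableType d) (R : realType)
    (P : probability T R) (F : R -> set_system T) (M A : R -> T -> R) : Prop :=
  [/\ adapted F A,
      continuous_paths P A,
      {ae P, forall w, forall s t, 0 <= s -> s <= t -> A s w <= A t w},
      vanishes_at_0 P A &
      local_martingale P F (fun t w => M t w ^+ 2 - A t w)].

(* Standard Brownian motion; [normal_prob] takes the standard deviation. *)
Definition wiener_process d (T : measurableType d) (R : realType)
    (P : probability T R) (W : R -> T -> R) : Prop :=
  [/\ forall t, 0 <= t -> measurable_fun [set: T] (W t),
      vanishes_at_0 P W,
      continuous_paths P W,
      forall s t, 0 <= s -> s < t -> forall B : set R, measurable B ->
        P [set w | B (W t w - W s w)] =
        normal_prob 0 (Num.sqrt (t - s)) B &
      forall (n : nat) (t : nat -> R) (B : nat -> set R),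
        0 <= t 0%N -> (forall i, t i <= t i.+1) ->
        (forall i, measurable (B i)) ->
        P [set w | forall i, (i < n)%N -> B i (W (t i.+1) w - W (t i) w)] =
        (\prod_(i < n) P [set w | B i (W (t i.+1) w - W (t i) w)%R])%E].

Definition process_sigma (T : Type) (R : realType) (X : R -> T -> R) :
    set_system T :=
  <<s [set E | exists t, exists B : set R,
         [/\ 0 <= t, measurable B & E = X t @^-1` B] ] >>.

Definition independent_processes d (T : measurableType d) (R : realType)
    (P : probability T R) (X Y : R -> T -> R) : Prop :=
  forall E E', process_sigma X E -> process_sigma Y E' ->
    P (E `&` E') = (P E * P E')%E.

(* (T', P') is an enlargement of (T, P): objects living on T are transported   *)
(* to T' by composition with the measure-preserving map p. The case p = id is  *)
(* the absence of enlargement.                                                 *)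
Definition enlargement d (T : measurableType d) d' (T' : measurableType d')
    (R : realType) (P : probability T R) (P' : probability T' R)
    (p : T' -> T) : Prop :=
  measurable_fun [set: T'] p /\
  forall E, measurable E -> P' (p @^-1` E) = P E.

Definition qv_infty (T : Type) (R : realType) (A : R -> T -> R) (w : T) :
    \bar R :=
  lim ((A t w)%:E @[t --> +oo%R]).

(* T_s = inf {t : A_t > s}, equal to +oo on the empty set. *)
Definition qv_inverse (T : Type) (R : realType) (A : R -> T -> R) (s : R)
    (w : T) : \bar R :=
  ereal_inf [set t%:E | t in [set t : R | 0 <= t /\ s < A t w]].

(* When A_oo = +oo the second branch is never taken and W(s) = M(T_s). *)
Definition dds_process (T T' : Type) (R : realType) (M A : R -> T -> R)
    (p : T' -> T) (beta : R -> T' -> R) : R -> T' -> R :=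
  fun s w =>
    if (s%:E < qv_infty A (p w))%E then M (fine (qv_inverse A s (p w))) (p w)
    else lim (M t (p w) @[t --> +oo%R])
         + beta (s - fine (qv_infty A (p w))) w.

(* The auxiliary process beta is only needed if A_oo is finite with positive   *)
(* probability.                                                                *)
Definition dds_enlargement d (T : measurableType d) d' (T' : measurableType d')
    (R : realType) (P : probability T R) (M A : R -> T -> R)
    (P' : probability T' R) (p : T' -> T) (beta : R -> T' -> R) : Prop :=
  enlargement P P' p /\
  ({ae P, forall w, qv_infty A w = +oo%E} \/
   wiener_process P' beta /\
   independent_processes P' beta (fun t w => M t (p w))).

(* Successive times at which the path x has moved by 2^-m; the inf is +oo on   *)
(* the empty set, and then so are all the later times.                         *)
Fixpoint crossing_time (R : realType) (x : R -> R) (m k : nat) : \bar R :=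
  if k is j.+1 then
    ereal_inf [set s%:E | s in [set s : R |
      (crossing_time x m j < s%:E)%E /\
      `|x s - x (fine (crossing_time x m j))| = 2 ^- m]]
  else 0%E.

(* Value at time t >= 0 of the linear interpolation of the points              *)
(* (k 2^-2m, x(s_m(k))), where s_m(k) = crossing_time x m k.                   *)
Definition shrunken_walk (R : realType) (x : R -> R) (m : nat) (t : R) : R :=
  let y k := x (fine (crossing_time x m k)) in
  let u := t * 2 ^+ (2 * m) in
  let k := Num.truncn u in
  y k + (u - k%:R) * (y k.+1 - y k).

(* The counted set is finite when x is continuous on [0, +oo[; fset_set sends  *)
(* an infinite set to the empty one.                                           *)
Definition discrete_qv (R : realType) (x : R -> R) (m : nat) (t : R) : R :=
  2 ^- (2 * m) *
  (#|` fset_set [set r : nat |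
        (0 < r)%N /\ (crossing_time x m r <= t%:E)%E] |)%:R.

(* sup_(0 <= t <= K) |M(t) - B_m(N_m(t))| on a path; the supremum is taken in  *)
(* the extended reals, so that it is +oo if unbounded.                         *)
Definition approx_error (T T' : Type) (R : realType) (M A : R -> T -> R)
    (p : T' -> T) (beta : R -> T' -> R) (m : nat) (K : R) (w : T') : \bar R :=
  let W := dds_process M A p beta in
  ereal_sup [set `|M t (p w)
                   - shrunken_walk (W ^~ w) m (discrete_qv (M ^~ (p w)) m t)|%:E
            | t in `[0, K]%classic].

(* Main.v *)
Require Import Defs.
From HB Require Import structures.
From mathcomp Require Import all_boot all_order all_algebra finmap.
From mathcomp Require Import all_classical all_reals all_analysis.
From mathcomp Require Import measurable_realfun ring lra.

Import Order.TTheory GRing.Theory Num.Theory.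
Import numFieldNormedType.Exports.

Local Open Scope classical_set_scope.
Local Open Scope ring_scope.

(** Both bounds hold because, almost surely, the error is at most [2 ^- m] for
    all [m] and [K] at once.  Let [k] be the number of crossings of mesh [2 ^- m]
    that [M] has completed at time [t], the last one at time [r].  The argument
    [k 2^-2m] of the walk is a node of the interpolation, so the walk takes there
    the value of [W] at its [k]-th crossing.  As [M = W \o A], where the time
    change [A] is continuous and constant only where [M] is constant, the
    crossings of [W] are those of [M] seen through [A]
    ([crossing_time_change]): the walk is at [W (A r) = M r].  Since [M] has not
    crossed again after [r], [M t] is within [2 ^- m] of [M r]
    ([dist_last_crossing]).  All this is pathwise ([approx_error_le]).

    The probabilistic input is that almost every path of [M] is constant on the
    intervals where [A = <M,M>] is constant ([local_martingale_flat]); it gives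
    both [M = W \o A] ([dds_process_qv]) and the correspondence of crossings.
    For fixed times [q <= r], the idea is that [(M t - a) ^+ 2] is a martingale
    as long as [A] keeps the value [A q], up to the localizing times, so that
    [M] cannot move away from [a] if [M q] is close to [a].  To be rigorous
    without a common localizing sequence for [M] and [M ^+ 2 - A], the
    combination [Z - 2 a X + a ^+ 2 + A q] of the two stopped martingales is
    used: it is a martingale at all times after [q], and equals
    [(M t - a) ^+ 2 >= 0] while neither localizing time is passed and [A] still
    has the value [A q].  A continuous martingale that is nonnegative up to a
    random time has at that time a nonnegative value, and optional stopping
    along finer and finer time grids bounds the mass of the paths that have
    moved ([martingale_running_ge0]).  Cutting the values of [M q] into slices
    of width [dl], the probability of a move larger than [eta] is of order
    [(dl / eta) ^+ 2] ([moved_slices]), hence zero. *)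

(** * Continuous paths on the half line *)

Lemma halfline_continuous_dist (R : realType) (x : R -> R) :
  {within `[0, +oo[, continuous x} ->
  forall t e : R, 0 <= t -> 0 < e ->
  exists2 d : R, 0 < d &
    forall u, 0 <= u -> `|u - t| < d -> `|x u - x t| < e.
Proof.
move=> /subspace_continuousP xc t e t0 e0.
have /cvgrPdist_lt/(_ e e0) : x @ within [set` `[0, +oo[] (nbhs t) --> x t.
  by apply: xc; rewrite /= in_itv/= t0.
rewrite /within/= => /nbhs_ballP[d /= d0 xd].
exists d => // u u0 utd; rewrite distrC; apply: xd; last by rewrite in_itv/= u0.
by rewrite /ball/= distrC.
Qed.

Lemma dist_halfline_continuous (R : realType) (x : R -> R) :
  (forall t e : R, 0 <= t -> 0 < e -> exists2 d : R, 0 < d &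
    forall u, 0 <= u -> `|u - t| < d -> `|x u - x t| < e) ->
  {within `[0, +oo[, continuous x}.
Proof.
move=> xd; apply/subspace_continuousP => t /=; rewrite in_itv/= andbT => t0.
apply/cvgrPdist_lt => e e0; have [d d0 {}xd] := xd _ _ t0 e0.
rewrite /within/= -filter_from_ballE; exists d => //= u tu.
rewrite in_itv/= andbT => u0; rewrite distrC; apply: xd => //.
by rewrite distrC.
Qed.

Lemma halfline_unif_continuous (R : realType) (x : R -> R) :
  {within `[0, +oo[, continuous x} ->
  forall K e : R, 0 < e ->
  exists2 d : R, 0 < d &
    forall u v, 0 <= u <= K -> 0 <= v -> `|v - u| < d -> `|x v - x u| < e.
Proof.
move=> xc K e e0.
have /compact_near_coveringP cK := @segment_compact R 0 K.
pose Q (d u : R) := 0 <= u -> forall v, 0 <= v -> `|v - u| < d -> `|x v - x u| < e.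
have : \forall d \near 0^'+, `[0, K] `<=` Q d.
  apply: cK => t /=; rewrite in_itv/= => /andP[t0 tK].
  have [d d0 xd] := halfline_continuous_dist _ _ xc _ _ t0 (divr_gt0 e0 (ltr0n R 2)).
  have d20 : 0 < d / 2 by rewrite divr_gt0.
  exists (ball t (d / 2), [set h | h < d / 2]) => /=.
    split; first exact: nbhsx_ballx.
    exact: nbhs_right_lt.
  move=> [u h] /= [tu hd] u0 v v0 vu.
  move: tu; rewrite /ball/= distrC => tu.
  have -> : x v - x u = (x v - x t) - (x u - x t) by ring.
  rewrite (le_lt_trans (ler_normB _ _))//.
  have -> : e = e / 2 + e / 2 by lra.
  rewrite ltrD// xd//; last by lra.
  have -> : v - t = (v - u) + (u - t) by ring.
  by rewrite (le_lt_trans (ler_normD _ _))//; lra.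
move=> [d /= d0 hd]; exists (d / 2); first by rewrite divr_gt0.
move=> u v /andP[u0 uK] v0 vu.
apply: (hd (d / 2)) => //=; rewrite ?sub0r ?normrN ?gtr0_norm ?divr_gt0//; [lra| ].
by rewrite in_itv/= u0.
Qed.

Lemma continuous_halfline_segment (R : realType) (x : R -> R) (r t : R) :
  0 <= r -> {within `[0, +oo[, continuous x} -> {within `[r, t], continuous x}.
Proof.
move=> r0; apply: continuous_subspaceW.
by move=> s /=; rewrite !in_itv/= andbT => /andP[/(le_trans r0)].
Qed.

(** * Crossing times *)

Lemma crossing_timeS (R : realType) (x : R -> R) m k :
  crossing_time x m k.+1 =
  ereal_inf [set s%:E | s in [set s : R | (crossing_time x m k < s%:E)%E /\
    `|x s - x (fine (crossing_time x m k))| = 2 ^- m]].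
Proof. by []. Qed.

Lemma crossing_time_ge0 (R : realType) (x : R -> R) m k :
  (0 <= crossing_time x m k)%E.
Proof.
elim: k => [//|k ih]; rewrite crossing_timeS; apply: le_ereal_inf_tmp => _ [s [ks _] <-].
exact: le_trans ih (ltW ks).
Qed.

Lemma crossing_time_homo (R : realType) (x : R -> R) m :
  {homo crossing_time x m : j k / (j <= k)%N >-> (j <= k)%E}.
Proof.
apply: homo_leq => // [? ? ?|k]; first exact: le_trans.
by rewrite crossing_timeS; apply: le_ereal_inf_tmp => _ [s [ks _] <-]; exact: ltW.
Qed.

Lemma crossing_time_succ_le (R : realType) (x : R -> R) m k (r s : R) :
  crossing_time x m k = r%:E -> r < s -> `|x s - x r| = 2 ^- m ->
  (crossing_time x m k.+1 <= s%:E)%E.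
Proof.
move=> kr rs xs; rewrite crossing_timeS; apply: ereal_inf_lbound.
by exists s; rewrite //= kr lte_fin.
Qed.

(** By continuity the path has still moved by [2 ^- m] at a limit of times at
    which it has; as it has not moved at the previous crossing itself, that
    limit is strictly later. *)
Lemma crossing_time_succ_attained (R : realType) (x : R -> R) m k (t : R) :
  {within `[0, +oo[, continuous x} -> crossing_time x m k.+1 = t%:E ->
  exists r, [/\ crossing_time x m k = r%:E, 0 <= r, r < t &
    `|x t - x r| = 2 ^- m].
Proof.
move=> xc kt.
have := crossing_time_ge0 _ x m k; have := crossing_time_homo _ x m _ _ (leqnSn k).
rewrite kt; case kr : (crossing_time x m k) => [r||] //; rewrite !lee_fin => rt r0.
exists r.
have m0 : 0 < 2 ^- m :> R by rewrite invr_gt0 exprn_gt0.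
suff xt : `|x t - x r| = 2 ^- m.
  split => //; rewrite lt_neqAle rt andbT; apply/eqP => rtE.
  by move: xt; rewrite rtE subrr normr0 => z; rewrite -z ltxx in m0.
apply/eqP; rewrite -subr_eq0 -normr_eq0; apply/eqP/le_anti; rewrite normr_ge0 andbT.
rewrite leNgt; apply/negP => e0.
have [d d0 xd] := halfline_continuous_dist _ _ xc _ _ (le_trans r0 rt) e0.
have : (crossing_time x m k.+1 < (t + d)%:E)%E by rewrite kt lte_fin ltrDl.
rewrite crossing_timeS => /ereal_inf_lt [_ [s /= [ks xs] <-]]; rewrite lte_fin => sd.
have ts : t <= s.
  rewrite -lee_fin -kt; apply: crossing_time_succ_le; first exact: kr.
    by rewrite kr lte_fin in ks.
  by rewrite kr in xs.
rewrite kr lte_fin in ks; rewrite kr /= in xs.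
have := xd s (le_trans r0 (ltW ks)); rewrite ger0_norm ?subr_ge0//.
move=> /(_ _)-/(_ ltac:(lra)); rewrite -xs ltNge => /negP; apply.
have -> : x s - x t = (x s - x r) - (x t - x r) by ring.
by rewrite distrC ler_dist_dist.
Qed.

(** Crossing times cannot accumulate, because a uniformly continuous path needs
    a time bounded below to move by [2 ^- m]. *)
Lemma crossing_time_bracket (R : realType) (x : R -> R) m (t : R) :
  {within `[0, +oo[, continuous x} -> 0 <= t ->
  exists k, (crossing_time x m k <= t%:E < crossing_time x m k.+1)%E.
Proof.
move=> xc t0.
have m0 : 0 < 2 ^- m :> R by rewrite invr_gt0 exprn_gt0.
have [d d0 xd] := halfline_unif_continuous _ _ xc t _ m0.
have spread k r : crossing_time x m k = r%:E -> r <= t -> k%:R * d <= r.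
  elim: k r => [r [<-] _|k ih s /[dup] ks /crossing_time_succ_attained-/(_ xc)].
    by rewrite mul0r.
  move=> [r [kr r0 rs xrs]] st; have rt := le_trans (ltW rs) st.
  have := ih _ kr rt; rewrite -natr1 mulrDl mul1r => kd.
  have : d <= s - r; last by lra.
  rewrite leNgt; apply/negP => sr.
  have := xd r s; rewrite xrs ltxx ger0_norm ?subr_ge0 ?(ltW rs)// r0 rt/=.
  by move=> /(_ isT) /(_ (le_trans r0 (ltW rs))) /(_ sr).
(* the crossings before t are at least d apart, so at most t / d of them fit *)
have exk : exists k, `[< (t%:E < crossing_time x m k)%E >].
  exists (Num.truncn (t / d)).+1; apply/asboolP; rewrite ltNge; apply/negP => kt.
  have := crossing_time_ge0 _ x m (Num.truncn (t / d)).+1.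
  case kr : (crossing_time _ _ _) kt => [r||]//; rewrite !lee_fin => rt r0.
  have := spread _ _ kr rt; rewrite leNgt => /negP; apply.
  by rewrite (le_lt_trans rt)// -ltr_pdivrMr// truncnS_gt.
have [k /asboolP tk kmin] := ex_minnP exk.
case: k tk kmin => [|k] tk kmin; first by rewrite /= lte_fin ltNge t0 in tk.
exists k; rewrite tk andbT leNgt; apply/negP => kt.
by have := kmin k; rewrite ltnn; move/asboolP : kt => kt /(_ kt).
Qed.

Lemma discrete_qv_bracket (R : realType) (x : R -> R) m (t : R) k :
  (crossing_time x m k <= t%:E < crossing_time x m k.+1)%E ->
  discrete_qv x m t = 2 ^- (2 * m) * k%:R.
Proof.
move=> /andP[kt tk]; rewrite /discrete_qv; congr (_ * _%:R).
rewrite (_ : [set r | _] = [set` [fset r in iota 1 k]%fset]).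
  by rewrite set_fsetK card_fseq undup_id ?iota_uniq// size_iota.
apply/seteqP; split => r /=; rewrite !inE mem_iota add1n ltnS.
  move=> [r0 rt]; rewrite r0/= leqNgt; apply/negP => kr.
  by have := lt_le_trans tk (le_trans (crossing_time_homo _ x m _ _ kr) rt); rewrite ltxx.
by move=> /andP[-> rk]; split => //; exact: le_trans (crossing_time_homo _ x m _ _ rk) kt.
Qed.

(** At a node the weight of the next value is zero, so it does not matter
    whether the walk has a next step. *)
Lemma shrunken_walk_node (R : realType) (y : R -> R) m k :
  shrunken_walk y m (2 ^- (2 * m) * k%:R) = y (fine (crossing_time y m k)).
Proof.
rewrite /shrunken_walk mulrAC mulVf ?mul1r; last by rewrite expf_neq0.
by rewrite natrK subrr mul0r addr0.
Qed.

(** To leave the band of half-width [2 ^- m] around its value at the last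
    crossing, the path would have to cross again. *)
Lemma dist_last_crossing (R : realType) (x : R -> R) m (t r : R) k :
  {within `[0, +oo[, continuous x} -> crossing_time x m k = r%:E ->
  0 <= r <= t -> (t%:E < crossing_time x m k.+1)%E ->
  `|x t - x r| <= 2 ^- m.
Proof.
move=> xc kr /andP[r0 rt] tk; rewrite leNgt; apply/negP => far.
have m0 : 0 < 2 ^- m :> R by rewrite invr_gt0 exprn_gt0.
have [|||u] := @IVT R (fun s => `|x s - x r|) r t (2 ^- m) => //.
- have xrt := continuous_halfline_segment _ _ _ t r0 xc.
  by move=> s; apply: cvg_norm; apply: cvgB; [exact: xrt|exact: cvg_cst].
- by rewrite subrr normr0 /= minElt normr_gt0 maxElt normr_gt0; case: ifPn => [_|];
    rewrite ?(ltW m0) ?(ltW far)//; rewrite negbK => /eqP z; move: (lt_trans m0 far); rewrite z normr0 ltxx.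
rewrite in_itv/= => /andP[ru ut] xu.
have ru' : r < u.
  rewrite lt_neqAle ru andbT; apply/eqP => ruE.
  by move: m0; rewrite -xu ruE subrr normr0 ltxx.
have := crossing_time_succ_le _ _ _ _ _ _ kr ru' xu => ku.
by have := lt_le_trans tk ku; rewrite lte_fin ltNge ut.
Qed.

(** The time change [a] is continuous, hence skips no time before [a r], so
    that [y] takes before [a r] only values that [x = y \o a] takes before [r];
    and as [a] is constant only where [x] is, a strictly later crossing of [x]
    is a strictly later crossing of [y]. *)
Lemma crossing_time_change (R : realType) (x a y : R -> R) m :
  {within `[0, +oo[, continuous x} -> {within `[0, +oo[, continuous a} ->
  (forall s t, 0 <= s -> s <= t -> a s <= a t) -> a 0 = 0 ->
  (forall s t, 0 <= s -> s <= t -> a s = a t -> x s = x t) ->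
  (forall t, 0 <= t -> y (a t) = x t) ->
  forall k r, crossing_time x m k = r%:E -> crossing_time y m k = (a r)%:E.
Proof.
move=> xc ac a_homo a0 flat ya; have m0 : 0 < 2 ^- m :> R by rewrite invr_gt0 exprn_gt0.
elim=> [r [<-]|k ih t /[dup] kt]; first by rewrite /= a0.
move=> /crossing_time_succ_attained-/(_ xc)[r [kr r0 rt xrt]].
have {}ih := ih _ kr; have t0 := le_trans r0 (ltW rt).
apply/eqP; rewrite eq_le; apply/andP; split.
  apply: crossing_time_succ_le; first exact: ih; last by rewrite !ya.
  rewrite lt_neqAle a_homo ?(ltW rt)// ?andbT; apply/eqP => art.
  by move: m0; rewrite -xrt (flat r t)// ?(ltW rt)// subrr normr0 ltxx.
rewrite crossing_timeS; apply: le_ereal_inf_tmp => _ [s [+ +] <-].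
rewrite ih lte_fin /= ya// => ars xs; rewrite lee_fin leNgt; apply/negP => sat.
have [|||u] := @IVT R a r t s => //.
- exact: ltW.
- exact: continuous_halfline_segment.
- by rewrite minElt maxElt (lt_trans ars sat) (ltW ars) (ltW sat).
rewrite in_itv/= => /andP[ru ut] aus.
have ru' : r < u.
  rewrite lt_neqAle ru andbT; apply/eqP => ruE.
  by rewrite ruE aus ltxx in ars.
move: xs; rewrite -aus ya ?(ltW (le_lt_trans r0 ru'))// => xu.
have := crossing_time_succ_le _ _ _ _ _ _ kr ru' xu; rewrite kt lee_fin => tu.
have tuE : u = t by apply/le_anti; rewrite ut tu.
by rewrite -aus tuE ltxx in sat.
Qed.

(** * The time-changed process *)

Lemma le_qv_infty (T : Type) (R : realType) (A : R -> T -> R) (w : T) (v : R) :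
  (forall s t, 0 <= s -> s <= t -> A s w <= A t w) -> 0 <= v ->
  ((A v w)%:E <= qv_infty A w)%E.
Proof.
move=> A_homo v0.
(* A is monotone on the half line only, so it is made constant before 0 *)
have ndA : {homo (fun t => (A (Order.max 0 t) w)%:E) : s t / s <= t >-> (s <= t)%E}.
  move=> s t st; rewrite lee_fin; apply: A_homo; first by rewrite le_max lexx.
  by rewrite ge_max !le_max lexx st orbT.
apply: lime_ge.
  apply/cvg_ex; eexists; apply: cvg_trans (nondecreasing_cvge ndA).
  apply: near_eq_cvg; near=> t; congr (A _ w)%:E.
  by apply/max_r; near: t; exact: nbhs_pinfty_ge.
near=> t; rewrite lee_fin A_homo//.
Unshelve. all: by end_near. Qed.

(** The right-continuous inverse of [A] takes [A t] to the last time at which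
    [A] equals [A t]; [M] has the same value there, hence [W (A t) = M t]. When
    [A t] is already the total variation, [M] stays put after [t], and the
    auxiliary process enters only through its initial value. *)
Lemma dds_process_qv (T T' : Type) (R : realType) (M A : R -> T -> R)
    (p : T' -> T) (beta : R -> T' -> R) (w : T') :
  {within `[0, +oo[, continuous (A ^~ (p w))} ->
  (forall s t, 0 <= s -> s <= t -> A s (p w) <= A t (p w)) ->
  (forall s t, 0 <= s -> s <= t -> A s (p w) = A t (p w) ->
     M s (p w) = M t (p w)) ->
  qv_infty A (p w) = +oo%E \/ beta 0 w = 0 ->
  forall t, 0 <= t -> dds_process M A p beta (A t (p w)) w = M t (p w).
Proof.
move=> Ac A_homo flat binit t t0; rewrite /dds_process.
have [[v [v0 tv]]|stuck] := pselect (exists v, 0 <= v /\ A t (p w) < A v (p w)).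
  have := le_qv_infty _ _ _ _ _ A_homo v0; move=> vinf.
  rewrite (lt_le_trans _ vinf) ?lte_fin//.
  rewrite /qv_inverse; set E := [set _ | _ in _].
  have lbE : lbound E t%:E.
    move=> _ [u [u0 tu] <-]; rewrite lee_fin leNgt; apply/negP => ut.
    by have := A_homo u t u0 (ltW ut); rewrite leNgt tu.
  have tE : (t%:E <= ereal_inf E)%E by apply: le_ereal_inf_tmp.
  have Ev : (ereal_inf E <= v%:E)%E by apply: ereal_inf_lbound; exists v.
  case r_def : (ereal_inf E) tE Ev => [r||]//; rewrite !lee_fin => tr rv /=.
  have r0 := le_trans t0 tr.
  apply/esym/flat => //; apply/le_anti; rewrite (A_homo t r)//= leNgt; apply/negP => tr'.
  have e0 : 0 < A r (p w) - A t (p w) by rewrite subr_gt0.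
  have [d d0 Ad] := halfline_continuous_dist _ _ Ac _ _ r0 e0.
  have rt : t < r.
    by rewrite lt_neqAle tr andbT; apply/eqP => rt; rewrite rt ltxx in tr'.
  pose u := Order.max t (r - d / 2).
  have ur : u < r by rewrite gt_max rt/= ltrBlDr ltrDl divr_gt0.
  have tu : t <= u by rewrite le_max lexx.
  have ru : r - d / 2 <= u by rewrite le_max lexx orbT.
  suff : (ereal_inf E <= u%:E)%E by rewrite r_def lee_fin leNgt ur.
  apply: ereal_inf_lbound; exists u => //; split; first exact: le_trans tu.
  have /Ad : 0 <= u by exact: le_trans tu.
  rewrite distrC ger0_norm ?subr_ge0 ?(ltW ur)// => /(_ ltac:(clear -d0 ru; lra)).
  by rewrite ltr_distl => /andP[+ _]; rewrite opprB addrC subrK.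
have cst u : t <= u -> A u (p w) = A t (p w).
  move=> tu; apply/le_anti; rewrite (A_homo t u)// andbT leNgt; apply/negP => tu'.
  by apply: stuck; exists u; split => //; exact: le_trans tu.
have infE : qv_infty A (p w) = (A t (p w))%:E.
  apply: lim_near_cst; first exact: ereal_hausdorff.
  by near=> u; rewrite cst.
rewrite infE ltxx /= subrr.
have -> : beta 0 w = 0 by case: binit => //; rewrite infE.
rewrite addr0; apply: lim_near_cst; first exact: Rhausdorff.
near=> u; have tu : t <= u by [].
by apply/esym/flat => //; rewrite cst.
Unshelve. all: by end_near. Qed.

(** With [k] crossings completed at time [t], the [k]-th one at [r], the walk is
    at the value of the time-changed process at [A r], which is [M r]. *)
Lemma approx_error_le (T T' : Type) (R : realType) (M A : R -> T -> R)
    (p : T' -> T) (beta : R -> T' -> R) (w : T') :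
  {within `[0, +oo[, continuous (M ^~ (p w))} ->
  {within `[0, +oo[, continuous (A ^~ (p w))} ->
  (forall s t, 0 <= s -> s <= t -> A s (p w) <= A t (p w)) ->
  A 0 (p w) = 0 ->
  (forall s t, 0 <= s -> s <= t -> A s (p w) = A t (p w) ->
     M s (p w) = M t (p w)) ->
  qv_infty A (p w) = +oo%E \/ beta 0 w = 0 ->
  forall m K, (approx_error M A p beta m K w <= (2 ^- m)%:E)%E.
Proof.
move=> Mc Ac A_homo A0 flat binit m K.
apply: ge_ereal_sup => _ [t + <-]; rewrite /= in_itv/= lee_fin => /andP[t0 _].
have [k kt] := crossing_time_bracket _ _ m _ Mc t0; rewrite (discrete_qv_bracket _ _ _ _ _ kt).
rewrite shrunken_walk_node; case/andP : kt => kt tk.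
have := crossing_time_ge0 _ (M ^~ (p w)) m k.
case kr : (crossing_time _ _ _) kt => [r||]//; rewrite !lee_fin => rt r0.
have WA := dds_process_qv _ _ _ _ _ _ _ _ Ac A_homo flat binit.
rewrite (crossing_time_change _ _ _ (fun s => dds_process M A p beta s w) m Mc Ac A_homo A0 flat WA _ _ kr).
rewrite /= WA//; apply: dist_last_crossing kr _ tk => //.
by rewrite r0.
Qed.

(** * Sub-sigma-algebras *)

(** Measurability with respect to a sub-sigma-algebra is measurability on the
    same carrier seen as another measurable type, which gives access to the
    closure properties of measurable functions. *)
Lemma sigma_algebra_gE d (T : measurableType d) (G : set_system T) :
  sigma_algebra [set: T] G ->
  (measurable : set_system (g_sigma_algebraType G)) = G.
Proof. exact: measurable_g_measurableTypeE. Qed.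

Lemma measurable_wrtP d (T : measurableType d) (R : realType)
    (G : set_system T) (X : T -> R) :
  sigma_algebra [set: T] G ->
  measurable_wrt G X <->
  measurable_fun [set: g_sigma_algebraType G] (X : g_sigma_algebraType G -> R).
Proof.
move=> GS; split => [XG _ B mB|mX B mB].
  by rewrite setTI sigma_algebra_gE//; exact: XG.
by have := mX measurableT B mB; rewrite setTI sigma_algebra_gE.
Qed.

Lemma sigma_algebra_setI d (T : measurableType d) (G : set_system T) A B :
  sigma_algebra [set: T] G -> G A -> G B -> G (A `&` B).
Proof.
move=> GS; rewrite -(sigma_algebra_gE _ _ _ GS); exact: measurableI.
Qed.

Lemma sigma_algebra_setU d (T : measurableType d) (G : set_system T) A B :
  sigma_algebra [set: T] G -> G A -> G B -> G (A `|` B).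
Proof.
move=> GS; rewrite -(sigma_algebra_gE _ _ _ GS); exact: measurableU.
Qed.

Lemma sigma_algebra_setD d (T : measurableType d) (G : set_system T) A B :
  sigma_algebra [set: T] G -> G A -> G B -> G (A `\` B).
Proof.
move=> GS; rewrite -(sigma_algebra_gE _ _ _ GS); exact: measurableD.
Qed.

Lemma measurable_wrt_le d (T : measurableType d) (R : realType)
    (G : set_system T) (X Y : T -> R) :
  sigma_algebra [set: T] G -> measurable_wrt G X -> measurable_wrt G Y ->
  G [set w | X w <= Y w].
Proof.
move=> GS /(measurable_wrtP _ _ _ _ _ GS) mX /(measurable_wrtP _ _ _ _ _ GS) mY.
rewrite -(sigma_algebra_gE _ _ _ GS) -[X in measurable X]setTI.
exact: measurable_fun_le.
Qed.

Lemma measurable_wrt_lt d (T : measurableType d) (R : realType)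
    (G : set_system T) (X Y : T -> R) :
  sigma_algebra [set: T] G -> measurable_wrt G X -> measurable_wrt G Y ->
  G [set w | X w < Y w].
Proof.
move=> GS mX mY; have -> : [set w | X w < Y w] = setT `\` [set w | Y w <= X w].
  by apply/seteqP; split => w /=; rewrite ltNge; [move/negP|case=> _ /negP].
case: (GS) => _ + _; apply; exact: measurable_wrt_le.
Qed.

(** * Optional stopping along a grid *)

Section prob_lemmas.
Context d (T : measurableType d) (R : realType) (P : probability T R).
Implicit Types (A B : set T).

Lemma fine_prob_setU A B : measurable A -> measurable B -> [disjoint A & B] ->
  fine (P (A `|` B)) = fine (P A) + fine (P B).
Proof.
by move=> mA mB; rewrite disj_set2E => /eqP AB; rewrite measureU// fineD// fin_num_measure.
Qed.

Lemma fine_prob_le A B : measurable A -> measurable B -> A `<=` B ->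
  fine (P A) <= fine (P B).
Proof.
move=> mA mB AB; apply: fine_le; rewrite ?fin_num_measure//.
by apply: le_measure; rewrite ?inE.
Qed.

Lemma prob_eventually_not (B : nat -> set T) (e : R) :
  (forall n, measurable (B n)) -> {ae P, forall w, \forall n \near \oo, ~ B n w} ->
  0 < e -> exists n, (P (B n) < e%:E)%E.
Proof.
move=> mB evB e0.
have mBU n : measurable (\bigcup_(k in [set k | (n <= k)%N]) B k).
  by apply: bigcup_measurable.
have : P (lim_sup_set B) = 0.
  apply: measure_negligible; first by apply: bigcapT_measurable.
  apply: negligibleS evB => w /= Bw [N _ NB].
  by have [k /= Nk Bk] := Bw N I; exact: NB Bk.
move=> limB; have := lim_sup_set_cvg P B mB.
rewrite [X in _ -> _ --> X](_ : _ = 0%E); last exact: limB.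
have fT : (P (\bigcup_(k in [set k | (0 <= k)%N]) B k) < +oo)%E.
  by rewrite ltey_eq fin_num_measure.
move=> /(_ fT) cB.
have : \forall n \near \oo, (P (\bigcup_(k in [set k | (n <= k)%N]) B k) < e%:E)%E.
  have : nbhs (0 : \bar R) [set x | (x < e%:E)%E].
    by apply: open_nbhs_nbhs; split; [exact: open_ereal_lt_ereal|rewrite /= lte_fin].
  by move=> /cB.
move=> [n _ /(_ n (leqnn n))/= Bn]; exists n; apply: le_lt_trans Bn.
by apply: le_measure; rewrite ?inE//; apply: bigcup_sup => /=.
Qed.

End prob_lemmas.

(** Optional stopping at the first exit from the decreasing events [D i].  The
    event [B n] collects the exits with a value below [- e]; it is known when
    they occur, so the martingale property allows to replace the value at the
    exit by a later one.  The other exits cost at most [e]. *)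
Lemma martingale_exit d (T : measurableType d) (R : realType)
    (P : probability T R) (G : nat -> set_system T) (U : nat -> T -> R)
    (D : nat -> set T) (e : R) :
  (forall i, sigma_algebra [set: T] (G i)) ->
  (forall i, G i `<=` measurable) ->
  (forall i, G i `<=` G i.+1) ->
  (forall i, measurable_wrt (G i) (U i)) ->
  (forall i, P.-integrable [set: T] (EFin \o U i)) ->
  (forall i E, G i E -> \int[P]_(w in E) U i w = \int[P]_(w in E) U i.+1 w) ->
  (forall i, G i (D i)) -> (forall i, D i.+1 `<=` D i) -> 0 <= e ->
  let B n := \big[setU/set0]_(i < n)
    ((D i `\` D i.+1) `&` [set w | U i.+1 w < - e]) in
  forall n, G n (B n) /\
    \int[P]_(w in B n) U n w + \int[P]_(w in D n) U n w
      <= \int[P]_(w in D 0%N) U 0%N w + e.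
Proof.
move=> GS Gm Gs Uad Ui Umart GD Ds e0 B n.
have GB k : G k (B k).
  elim: k => [|k ih]; first by rewrite /B big_ord0; case: (GS 0%N).
  rewrite /B big_ord_recr/=; apply: (sigma_algebra_setU _ _ _ _ _ (GS k.+1)); first exact: Gs.
  apply: (sigma_algebra_setI _ _ _ _ _ (GS k.+1)).
    by apply: (sigma_algebra_setD _ _ _ _ _ (GS k.+1)) => //; exact: Gs.
  apply: (measurable_wrt_lt _ _ _ _ (U k.+1) (cst (- e))) => //.
  by apply/measurable_wrtP => //; exact: measurable_cst.
split => //.
have Dn k : D k `<=` D 0%N by elim: k => // k ih; exact: subset_trans (Ds k) ih.
have BD k : B k `<=` ~` D k.
  elim: k => [|k ih] w; first by rewrite /B big_ord0.
  by rewrite /B big_ord_recr/= => -[/ih Dw /Ds//|[[]]].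
have mD k : measurable (D k) by exact: Gm (GD k).
have mB k : measurable (B k) by exact: Gm (GB k).
have Uint k E : measurable E -> P.-integrable E (EFin \o U k).
  by move=> mE; exact: integrableS (Ui k).
suff : \int[P]_(w in B n) U n w + \int[P]_(w in D n) U n w
    <= \int[P]_(w in D 0%N) U 0%N w + e * fine (P (D 0%N `\` D n)).
  move/le_trans; apply; rewrite lerD2l ler_piMr//.
  rewrite -lee_fin fineK ?fin_num_measure//; last exact: measurableD.
  by apply: probability_le1; exact: measurableD.
elim: n => [|n ih]; first by rewrite /B big_ord0 Rintegral_set0 setDv measure0 mulr0 add0r addr0.
set b := (D n `\` D n.+1) `&` [set w | U n.+1 w < - e].
have Bn : B n.+1 = B n `|` b by rewrite /B big_ord_recr.
have mex : measurable (D n `\` D n.+1) by exact: measurableD.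
have mb : measurable b.
  have -> : b = B n.+1 `\` B n.
    rewrite Bn setDUl setDv set0U setDidl//; apply/disjoints_subset.
    by move=> w [[Dw _] _] /BD.
  exact: measurableD.
have bex : b `<=` D n `\` D n.+1 by move=> w [].
rewrite Bn Rintegral_setU//; [|by apply: Uint; exact: measurableU|]; last first.
  by apply/disj_setPS => w [/BD Dw [[]]].
have DnE : D n = D n.+1 `|` (D n `\` D n.+1) by rewrite setDUK.
have exE : D n `\` D n.+1 = b `|` ((D n `\` D n.+1) `\` b) by rewrite setDUK.
have DE : \int[P]_(w in D n) U n.+1 w = \int[P]_(w in D n.+1) U n.+1 w +
    (\int[P]_(w in b) U n.+1 w + \int[P]_(w in (D n `\` D n.+1) `\` b) U n.+1 w).
  rewrite {1}DnE Rintegral_setU//; last by apply/disj_setPS => w [? []].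
    rewrite {1}exE Rintegral_setU//; last by apply/disj_setPS => w [? []].
    - exact: measurableD.
    - by rewrite -exE; exact: Uint.
  by rewrite -DnE; exact: Uint.
have rest : - e * fine (P (D n `\` D n.+1)) <=
    \int[P]_(w in (D n `\` D n.+1) `\` b) U n.+1 w.
  have mr : measurable ((D n `\` D n.+1) `\` b) by exact: measurableD.
  apply: (@le_trans _ _ (- e * fine (P ((D n `\` D n.+1) `\` b)))).
    by rewrite ler_wnM2l ?oppr_le0//; apply: fine_prob_le.
  rewrite -Rintegral_cst//; apply: le_Rintegral => //.
  - by apply: finite_measure_integrable_cst.
  - exact: Uint.
  - by move=> w [Dw nb]; rewrite leNgt; apply/negP => Uw; exact: nb.
have step : fine (P (D 0%N `\` D n.+1)) =
    fine (P (D 0%N `\` D n)) + fine (P (D n `\` D n.+1)).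
  rewrite -fine_prob_setU//.
  - congr (fine (P _)); apply/seteqP; split => w.
      by move=> [D0 Dw]; have [?|?] := pselect (D n w); [right|left].
    by move=> [[D0 Dw]|[Dw Dw']]; split => //; [move/Ds|exact: Dn Dw].
  - exact: measurableD.
  - by apply/disj_setPS => w [[_ ?] []].
move: ih; rewrite step (Umart n _ (GB n)) (Umart n _ (GD n)) DE mulrDr.
move: rest; rewrite mulNr; clear; lra.
Qed.

(** Here [C t] is the event that the process still runs at time [t].  Stopping at
    the first grid time at which it does not run leaves the integral of [U]
    unchanged.  At the previous grid time [U] was nonnegative, so by uniform
    continuity it can be below [- e / 2] at the stopping time only on an event
    [B n] whose probability tends to [0] with the mesh; there [U r] may replace
    the stopped value, and its integral is small by absolute continuity.  On the
    paths of [E] the process runs up to [r]. *)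
Lemma martingale_running_ge0 d (T : measurableType d) (R : realType)
    (P : probability T R) (F : R -> set_system T) (q r : R) (U : R -> T -> R)
    (C : R -> set T) (E : set T) :
  filtration F -> 0 <= q <= r ->
  (forall t, q <= t <= r -> measurable_wrt (F t) (U t)) ->
  (forall t, q <= t <= r -> P.-integrable [set: T] (EFin \o U t)) ->
  (forall s t H, q <= s -> s <= t -> t <= r -> F s H ->
     \int[P]_(w in H) U s w = \int[P]_(w in H) U t w) ->
  {ae P, forall w, {within `[0, +oo[, continuous (U ^~ w)}} ->
  (forall t, q <= t <= r -> F t (C t)) ->
  (forall t w, q <= t <= r -> C t w -> 0 <= U t w) ->
  measurable E -> {ae P, forall w, E w -> forall t, q <= t <= r -> C t w} ->
  \int[P]_(w in E) U r w <= \int[P]_(w in C q) U q w.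
Proof.
move=> [FS Fm Fs] /andP[q0 qr] Uad Ui Umart Uc CF C0 mE EC.
have r0 := le_trans q0 qr.
have qrr : q <= r <= r by rewrite qr lexx.
have qqr : q <= q <= r by rewrite qr lexx.
apply/ler_addgt0Pr => e e0.
(* the grid of mesh h n from q to r, continued by the constant r *)
pose h n : R := (r - q) / n.+1%:R.
pose t n i := Order.min r (q + i%:R * h n).
have h0 n : 0 <= h n by rewrite divr_ge0// subr_ge0.
have tq n i : q <= t n i by rewrite le_min qr lerDl mulr_ge0.
have tr n i : t n i <= r by rewrite ge_min lexx.
have tqr n i : q <= t n i <= r by rewrite tq tr.
have ts n i : t n i <= t n i.+1 
  by rewrite {2}/t le_min tr/= ge_min lerD2l ler_wpM2r ?ler_nat ?orbT.
have tsh n i : t n i.+1 - t n i <= h n.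
  rewrite /t -natr1 mulrDl mul1r lerBlDr ge_min.
  case: (leP r (q + i%:R * h n)) => _; first by rewrite lerDr h0.
  by apply/orP; right; have := h0 n; lra.
have t0 n : t n 0%N = q by rewrite /t mul0r addr0 min_r.
have tN n : t n n.+1 = r.
  by rewrite /t /h mulrCA divff ?mulr1 ?pnatr_eq0// addrC subrK minxx.
have e2 : 0 < e / 2 by rewrite divr_gt0.
pose D n i := \big[setI/setT]_(j < i.+1) C (t n j).
pose b n i := (D n i `\` D n i.+1) `&` [set w | U (t n i.+1) w < - (e / 2)].
pose B n := \big[setU/set0]_(i < n.+1) b n i.
have DS n i : D n i.+1 = D n i `&` C (t n i.+1) by rewrite /D big_ord_recr.
have Ds n i : D n i.+1 `<=` D n i by rewrite DS; exact: subIsetl.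
have DC n i : D n i `<=` C (t n i) by rewrite /D big_ord_recr/=; exact: subIsetr.
have D0 n : D n 0%N = C q by rewrite /D big_ord_recr big_ord0/= setTI t0.
have tge0 n i : 0 <= t n i by exact: le_trans (tq n i).
have FD n i : F (t n i) (D n i).
  elim: i => [|i ih]; first by rewrite D0 t0; exact: CF.
  rewrite DS; apply: (sigma_algebra_setI _ _ _ _ _ (FS _ (tge0 _ _))).
    by apply: Fs ih.
  exact: CF.
have exitn n := martingale_exit _ _ _ P (fun i => F (t n i)) (fun i => U (t n i))
  (D n) (e / 2) (fun i => FS _ (tge0 n i)) (fun i => Fm _ (tge0 n i))
  (fun i => Fs _ _ (tge0 n i) (ts n i)) (fun i => Uad _ (tqr n i))
  (fun i => Ui _ (tqr n i)) (fun i H => Umart _ _ H (tq n i) (ts n i) (tr n i.+1))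
  (FD n) (Ds n) (ltW e2) n.+1.
have mB n : measurable (B n) by have [/(Fm _ (tge0 _ _))] := exitn n.
have mD n i : measurable (D n i) by exact: (Fm _ (tge0 n i)).
have evB : {ae P, forall w, \forall n \near \oo, ~ B n w}.
  apply: filterS Uc => w Uw.
  have [dl dl0 Udl] := halfline_unif_continuous _ _ Uw r _ e2.
  near=> n; rewrite /B -(bigcup_mkord n.+1 (b n)) => -[i /= ni [[Di _] Ui1]].
  have hn : h n < dl.
    rewrite ltr_pdivrMr// mulrC -ltr_pdivrMr//.
    by apply: (@lt_trans _ _ n%:R); [near: n; exact: nbhs_infty_gtr|rewrite ltr_nat].
  have := Udl (t n i) (t n i.+1); rewrite tge0 tr => /(_ isT (tge0 _ _)).
  rewrite ger0_norm ?subr_ge0// => /(_ (le_lt_trans (tsh _ _) hn)).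
  rewrite ltr_distl => /andP[+ _]; have := C0 _ _ (tqr n i) (DC _ _ _ Di).
  by move: Ui1 => /=; clear; lra.
have [dl [dl0 Udl]] := integral_normr_continuous (Ui _ qrr) e2.
have [n Bn] := prob_eventually_not _ _ _ P B dl mB evB dl0.
have {Udl} := Udl _ (mB n) Bn.
have Ur H : measurable H -> P.-integrable H (EFin \o U r).
  by move=> mH; exact: integrableS (Ui _ qrr).
have /(_ (mB n) (Ur _ (mB n))) := @le_normr_Rintegral _ _ _ P (B n) (U r).
rewrite ler_norml => /andP[Blow _] Bup.
have [_] := exitn n; rewrite -/(B n) tN t0 D0 => stop.
suff : \int[P]_(w in E) U r w <= \int[P]_(w in D n n.+1) U r w.
  by move: Blow Bup stop; clear; lra.
have DE : D n n.+1 = (D n n.+1 `&` E) `|` (D n n.+1 `\` E) by rewrite setUIDK.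
have EE : E = (D n n.+1 `&` E) `|` (E `\` D n n.+1) by rewrite setIC setUIDK.
have ED0 : \int[P]_(w in E `\` D n n.+1) U r w = 0.
  rewrite /Rintegral null_set_integral//.
  - exact: measurableD.
  - by case/integrableP : (Ur _ (measurableD mE (mD n n.+1))).
  - apply: measure_negligible; first exact: measurableD.
    apply: negligibleS EC => w [Ew nD] /= EwC; apply: nD.
    by rewrite /D -(bigcap_mkord n.+2 (fun j => C (t n j))) => i _; apply: EwC.
have mDE := measurableI _ _ (mD n n.+1) mE.
have mDdE := measurableD (mD n n.+1) mE; have mEdD := measurableD mE (mD n n.+1).
rewrite DE {1}EE !Rintegral_setU ?ED0//.
- rewrite addr0 lerDl; apply: Rintegral_ge0 => w [Dw _].
  by apply: C0 => //; rewrite -(tN n); exact: DC.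
- by rewrite -DE; exact: Ur.
- by apply/disj_setPS => w [[_ ?] []].
- by rewrite -EE; exact: Ur.
- by apply/disj_setPS => w [[? _] []].
Unshelve. all: by end_near. Qed.

(** * Constancy of a local martingale where its quadratic variation is constant *)

Lemma stopped_lt (T : Type) (R : realType) (X : R -> T -> R) S t w :
  (t%:E < S w)%E -> stopped X S t w = X t w.
Proof. by move=> tS; rewrite /stopped min_l ?ltW. Qed.

Lemma stopped_continuous (T : Type) (R : realType) (X : R -> T -> R)
    (S : T -> \bar R) w :
  (0 <= S w)%E -> {within `[0, +oo[, continuous (X ^~ w)} ->
  {within `[0, +oo[, continuous (stopped X S ^~ w)}.
Proof.
rewrite /stopped; case: (S w) => [s||]//; last first.
  by have -> : (fun t => X (fine (Order.min t%:E +oo%E)) w) = X ^~ w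
    by apply/funext => t; rewrite miney.
rewrite lee_fin => s0 xc; apply: dist_halfline_continuous => t e t0 e0.
have min0 u : 0 <= u -> 0 <= Order.min u s by move=> u0; rewrite le_min u0.
have [d d0 xd] := halfline_continuous_dist _ _ xc _ _ (min0 _ t0) e0.
exists d => // u u0 ut; rewrite -!EFin_min/=; apply: xd; first exact: min0.
apply: le_lt_trans ut; case: (leP u s) => us; case: (leP t s) => ts //.
- by rewrite ler0_norm ?ler0_norm; lra.
- by rewrite ger0_norm ?ger0_norm; lra.
- by rewrite subrr normr0.
Qed.

Lemma martingale_Rintegral d (T : measurableType d) (R : realType)
    (P : probability T R) (F : R -> set_system T) (X : R -> T -> R) s t H :
  martingale P F X -> 0 <= s -> s <= t -> F s H ->
  \int[P]_(w in H) X s w = \int[P]_(w in H) X t w.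
Proof.
by move=> [_ _ XM] s0 st FH; have [_ _ /(_ _ FH) XH] := XM s t s0 st; rewrite /Rintegral XH.
Qed.

Lemma stopping_time_gt d (T : measurableType d) (R : realType)
    (F : R -> set_system T) (S : T -> \bar R) (t : R) :
  filtration F -> stopping_time F S -> 0 <= t -> F t [set w | (t%:E < S w)%E].
Proof.
move=> [FS _ _] [_ mS] t0.
have -> : [set w | (t%:E < S w)%E] = [set: T] `\` [set w | (S w <= t%:E)%E].
  by apply/seteqP; split => w /=; rewrite ltNge; [move/negP|case=> _ /negP].
by case: (FS _ t0) => _ + _; apply; exact: mS.
Qed.

Section flat.
Context d (T : measurableType d) (R : realType) (P : probability T R).
Variables (F : R -> set_system T) (M A : R -> T -> R) (S1 S2 : T -> \bar R).
Hypotheses (FF : filtration F) (Mad : adapted F M) (Aad : adapted F A).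
Hypotheses (Mc : continuous_paths P M) (Ac : continuous_paths P A).
Hypothesis A_homo :
  {ae P, forall w, forall s t, 0 <= s -> s <= t -> A s w <= A t w}.
Hypotheses (S1F : stopping_time F S1) (S2F : stopping_time F S2).
Hypothesis Xm : martingale P F (stopped M S1).
Hypothesis Zm : martingale P F (stopped (fun t w => M t w ^+ 2 - A t w) S2).
Variables (q r L : R).
Hypothesis qr : 0 <= q <= r.

Let q0 : 0 <= q. Proof. by case/andP : qr. Qed.
Let r0 : 0 <= r. Proof. by case/andP : qr => /le_trans; apply. Qed.
Let FS t : 0 <= t -> sigma_algebra [set: T] (F t).
Proof. by case: FF => + _ _; apply. Qed.
Let Fm t : 0 <= t -> F t `<=` measurable.
Proof. by case: FF => _ + _; apply. Qed.
Let Fs s t : 0 <= s -> s <= t -> F s `<=` F t.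
Proof. by case: FF => _ _; apply. Qed.
Let Ft_cst t c : 0 <= t -> measurable_wrt (F t) (cst c : T -> R).
Proof. by move=> t0; apply/measurable_wrtP; [exact: FS|exact: measurable_cst]. Qed.
Let Fq_t (X : T -> R) t : q <= t -> measurable_wrt (F q) X -> measurable_wrt (F t) X.
Proof. by move=> qt mX B /mX; exact: Fs. Qed.

Let slice a dl := [set w | a <= M q w] `&` [set w | M q w < a + dl].

(** The bound [L] makes [A q] integrable on this event. *)
Let start a dl := slice a dl `&`
  [set w | `|A q w| <= L] `&` [set w | (q%:E < S1 w)%E] `&` [set w | (q%:E < S2 w)%E].

Let running a dl t := start a dl `&` [set w | A t w <= A q w] `&`
  [set w | A q w <= A t w] `&` [set w | (t%:E < S1 w)%E] `&` [set w | (t%:E < S2 w)%E].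

Let boundedA : F q [set w | `|A q w| <= L].
Proof.
apply: (measurable_wrt_le _ _ _ _ (fun w => `|A q w|) (cst L)); [exact: FS| |exact: Ft_cst].
apply/measurable_wrtP; first exact: FS.
apply: measurableT_comp => //; apply/measurable_wrtP; [exact: FS|exact: Aad].
Qed.

Let F_slice a dl : F q (slice a dl).
Proof.
apply: (sigma_algebra_setI _ _ _ _ _ (FS _ q0)).
  by apply: (measurable_wrt_le _ _ _ _ (cst a) (M q)); [exact: FS|exact: Ft_cst|exact: Mad].
by apply: (measurable_wrt_lt _ _ _ _ (M q) (cst (a + dl))); [exact: FS|exact: Mad|exact: Ft_cst].
Qed.

Let F_start a dl : F q (start a dl).
Proof.
have FI := fun B C => sigma_algebra_setI _ _ _ B C (FS _ q0).
apply: (FI); last exact: stopping_time_gt.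
apply: (FI); last exact: stopping_time_gt.
by apply: (FI); [exact: F_slice|exact: boundedA].
Qed.

Let F_running a dl t : q <= t -> F t (running a dl t).
Proof.
move=> qt; have t0 := le_trans q0 qt.
have FI := fun B C => sigma_algebra_setI _ _ _ B C (FS _ t0).
have Aq := Fq_t _ _ qt (Aad _ q0).
apply: (FI); last exact: stopping_time_gt.
apply: (FI); last exact: stopping_time_gt.
apply: (FI); last by apply: (measurable_wrt_le _ _ _ _ _ _ (FS _ t0) Aq); exact: Aad.
apply: (FI); last by apply: (measurable_wrt_le _ _ _ _ _ _ (FS _ t0) _ Aq); exact: Aad.
by apply: (Fs _ _ q0 qt); exact: F_start.
Qed.

(** On [start a dl] this is [Z t - 2 a X t + a ^+ 2 + A q], where [X] and [Z] are
    the stopped martingales; the indicator makes it integrable everywhere. *)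
Let U a t w := stopped (fun t w => M t w ^+ 2 - A t w) S2 t w
  - 2 * a * stopped M S1 t w + (a ^+ 2 + A q w * \1_[set w | `|A q w| <= L] w).

Let U_running a dl t w : running a dl t w -> U a t w = (M t w - a) ^+ 2.
Proof.
move=> [[[[[[[_ Aq] _] _] Atq] Aqt] tS1] tS2].
rewrite /U !stopped_lt// indicE mem_set// mulr1.
have -> : A t w = A q w by apply/le_anti/andP.
by ring.
Qed.

Let U_adapted a t : q <= t -> measurable_wrt (F t) (U a t).
Proof.
move=> qt; have t0 := le_trans q0 qt; have St := FS _ t0.
have [Xad _ _] := Xm; have [Zad _ _] := Zm.
have /(measurable_wrtP _ _ _ _ _ St) mX := Xad _ t0.
have /(measurable_wrtP _ _ _ _ _ St) mZ := Zad _ t0.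
have /(measurable_wrtP _ _ _ _ _ St) mA := Fq_t _ _ qt (Aad _ q0).
have /(measurable_wrtP _ _ _ _ _ St) mc := Ft_cst t (2 * a) t0.
have /(measurable_wrtP _ _ _ _ _ St) ma := Ft_cst t (a ^+ 2) t0.
apply/measurable_wrtP => //; apply: measurable_funD.
  by apply: measurable_funB => //; apply: measurable_funM.
apply: measurable_funD => //; apply: measurable_funM => //.
apply: measurable_indic; rewrite (sigma_algebra_gE _ _ _ St).
exact: (Fs _ _ q0 qt).
Qed.

Let A_integrable :
  P.-integrable [set: T] (EFin \o (fun w => A q w * \1_[set w | `|A q w| <= L] w)).
Proof.
apply: measurable_bounded_integrable => //.
- by rewrite ltey_eq fin_num_measure.
- apply: measurable_funM.
    move=> _ B mB; rewrite setTI; apply: (Fm _ q0); exact: (Aad _ q0).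
  by apply: measurable_indic; apply: (Fm _ q0).
- exists `|L|; split; first exact: num_real.
  move=> K LK w _ /=; apply: le_trans (ltW LK).
  rewrite indicE; have [wL|_] := boolP (w \in _); last by rewrite mulr0 normr0.
  by rewrite mulr1; apply: le_trans (ler_norm L); rewrite inE in wL.
Qed.

Let U_integrable a t : 0 <= t -> P.-integrable [set: T] (EFin \o U a t).
Proof.
move=> t0; have [_ Xi _] := Xm; have [_ Zi _] := Zm.
have := integrableD measurableT (integrableB measurableT (Zi t t0)
    (integrableZl measurableT (2 * a) (Xi t t0)))
  (integrableD measurableT (finite_measure_integrable_cst P (a ^+ 2) measurableT) A_integrable).
by apply: eq_integrable.
Qed.

Let U_martingale a s t H : q <= s -> s <= t -> F s H ->
  \int[P]_(w in H) U a s w = \int[P]_(w in H) U a t w.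
Proof.
move=> qs st FH; have s0 := le_trans q0 qs; have t0 := le_trans s0 st.
have mH := Fm _ s0 _ FH; have [_ Xi _] := Xm; have [_ Zi _] := Zm.
have onH f : P.-integrable [set: T] f -> P.-integrable H f.
  by apply: integrableS.
have Ui := onH _ (integrableD measurableT
  (finite_measure_integrable_cst P (a ^+ 2) measurableT) A_integrable).
have split u : 0 <= u -> \int[P]_(w in H) U a u w =
    \int[P]_(w in H) stopped (fun t w => M t w ^+ 2 - A t w) S2 u w -
    2 * a * \int[P]_(w in H) stopped M S1 u w +
    \int[P]_(w in H) (a ^+ 2 + A q w * \1_[set w | `|A q w| <= L] w).
  move=> u0; have Xu := onH _ (Xi u u0); have Zu := onH _ (Zi u u0).
  have aXu := integrableZl mH (2 * a) Xu.
  rewrite -RintegralZl// -RintegralB// -RintegralD//.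
  by apply: eq_integrable (integrableB mH Zu aXu).
rewrite !split// (martingale_Rintegral _ _ _ _ _ _ _ _ _ Xm s0 st FH).
by rewrite (martingale_Rintegral _ _ _ _ _ _ _ _ _ Zm s0 st FH).
Qed.

Let U_continuous a : {ae P, forall w, {within `[0, +oo[, continuous (U a ^~ w)}}.
Proof.
apply: filterS2 Mc Ac => w Mw Aw.
have Xw := stopped_continuous _ _ _ _ _ (S1F.1 w) Mw.
have Zw := @stopped_continuous _ _ (fun t w => M t w ^+ 2 - A t w) _ _ (S2F.1 w).
move=> t; apply: cvgD; last exact: cvg_cst.
apply: cvgB; last by apply: cvgM; [exact: cvg_cst|exact: Xw].
apply: Zw => u; apply: cvgB; last exact: Aw.
by apply: cvgM; exact: Mw.
Qed.

Let moved eta := [set w | `|A q w| <= L] `&` [set w | A r w <= A q w] `&`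
  [set w | A q w <= A r w] `&`
  [set w | (r%:E < S1 w)%E] `&` [set w | (r%:E < S2 w)%E] `&`
  [set w | eta <= `|M r w - M q w|].

Let q_le_r : q <= r. Proof. by case/andP : qr. Qed.

Let measurable_slice a dl : measurable (slice a dl).
Proof. by apply: (Fm _ q0); exact: F_slice. Qed.

Let measurable_moved eta : measurable (moved eta).
Proof.
apply: (Fm _ r0); have FI := fun B C => sigma_algebra_setI _ _ _ B C (FS _ r0).
have Fr X := Fq_t X _ q_le_r.
apply: (FI).
  apply: (FI); last exact: stopping_time_gt.
  apply: (FI); last exact: stopping_time_gt.
  apply: (FI); last by apply: measurable_wrt_le; [exact: FS|apply: Fr; exact: Aad|exact: Aad].
  apply: (FI); first exact: (Fs _ _ q0 q_le_r _ boundedA).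
  by apply: measurable_wrt_le; [exact: FS|exact: Aad|apply: Fr; exact: Aad].
apply: (measurable_wrt_le _ _ _ _ (cst eta) (fun w => `|M r w - M q w|)).
- exact: FS.
- exact: Ft_cst.
- have /(measurable_wrtP _ _ _ _ _ (FS _ r0)) mr := Mad r r0.
  have /(measurable_wrtP _ _ _ _ _ (FS _ r0)) mq := Fr _ (Mad q q0).
  apply/measurable_wrtP; first exact: FS.
  by apply: measurableT_comp => //; exact: measurable_funB.
Qed.

(** The slice replaces the random level [M q] by the constant [a], which keeps
    [(M t - a) ^+ 2 - A t] a martingale. *)
Let moved_slice a dl eta : dl <= eta ->
  (eta - dl) ^+ 2 * fine (P (slice a dl `&` moved eta)) <=
    dl ^+ 2 * fine (P (slice a dl)).
Proof.
move=> dle; set E := _ `&` _.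
have mE : measurable E by apply: measurableI.
have start_q w : running a dl q w -> slice a dl w by case=> [[[[[[[]]]]]]].
have mrun : measurable (running a dl q) by apply: (Fm _ q0); exact: F_running.
have tge0 t : q <= t <= r -> 0 <= t by move=> /andP[/(le_trans q0)].
have Er w : E w -> running a dl r w.
  move=> [[aM Ma] [[[[[AL Arq] Aqr] rS1] rS2] _]].
  have qS S : (r%:E < S)%E -> (q%:E < S)%E by apply: le_lt_trans; rewrite lee_fin.
  by do !split => //; exact: qS.
have Uint t H : 0 <= t -> measurable H -> P.-integrable H (EFin \o U a t).
  by move=> t0 mH; exact: integrableS (U_integrable a t t0).
have cint c H : measurable H -> P.-integrable H (EFin \o cst (c : R)).
  by move=> mH; exact: finite_measure_integrable_cst.
have low : (eta - dl) ^+ 2 * fine (P E) <= \int[P]_(w in E) U a r w.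
  rewrite -(Rintegral_cst _ mE); apply: le_Rintegral => //.
  - exact: cint.
  - exact: Uint.
  - move=> w Ew; rewrite (U_running _ _ _ _ (Er _ Ew)).
    move: Ew => [[/= aM Ma] [_ /= etaM]].
    rewrite -[leRHS](real_normK (num_real _)) ler_pXn2r ?nnegrE ?subr_ge0//.
    have -> : M r w - a = (M r w - M q w) - (a - M q w) by ring.
    apply: le_trans (lerB_dist _ _); rewrite lerB// ler0_norm; lra.
have up : \int[P]_(w in running a dl q) U a q w <= dl ^+ 2 * fine (P (slice a dl)).
  apply: (@le_trans _ _ (dl ^+ 2 * fine (P (running a dl q)))); last first.
    by rewrite ler_wpM2l ?sqr_ge0//; apply: fine_prob_le.
  rewrite -(Rintegral_cst _ mrun); apply: le_Rintegral => //.
  - exact: Uint.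
  - exact: cint.
  - move=> w rw; rewrite (U_running _ _ _ _ rw).
    have [] := start_q _ rw => /= aM Ma.
    by rewrite ler_pXn2r ?nnegrE//; lra.
apply: le_trans low (le_trans _ up).
apply: (martingale_running_ge0 _ _ _ _ F) => //.
- by move=> t /andP[qt _]; exact: U_adapted.
- by move=> t /tge0; exact: U_integrable.
- by move=> s t H qs st _; exact: U_martingale.
- by move=> t /andP[qt _]; exact: F_running.
- by move=> t w _ rw; rewrite (U_running _ _ _ _ rw) sqr_ge0.
- apply: filterS A_homo => w Aw /Er[[[[st Arq] Aqr] rS1] rS2] t /andP[qt tr].
  have tS S : (r%:E < S)%E -> (t%:E < S)%E by apply: le_lt_trans; rewrite lee_fin.
  have Aqt := Aw q t q0 qt; have Atr := Aw t r (le_trans q0 qt) tr.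
  by do !split => //; [exact: le_trans Atr Arq|exact: tS|exact: tS].
Qed.

(** Adjacent slices add up, with the same ratio [(dl / (eta - dl)) ^+ 2]. *)
Let moved_slices a dl eta n : 0 <= dl <= eta ->
  (eta - dl) ^+ 2 * fine (P (slice a (dl * n%:R) `&` moved eta)) <=
    dl ^+ 2 * fine (P (slice a (dl * n%:R))).
Proof.
move=> /andP[dl0 dle]; elim: n => [|n ih].
  rewrite mulr0; have -> : slice a 0 = set0.
    by apply/seteqP; split => w // -[/= aM]; rewrite addr0 ltNge aM.
  by rewrite set0I measure0 !mulr0.
have cut : slice a (dl * n.+1%:R) = slice a (dl * n%:R) `|` slice (a + dl * n%:R) dl.
  have ndl : 0 <= dl * n%:R by rewrite mulr_ge0.
  rewrite -natr1 mulrDr mulr1; apply/seteqP; split => w /=.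
    move=> [aM Ma]; have [?|?] := ltP (M q w) (a + dl * n%:R); [left|right] => //.
    by split => //=; rewrite -addrA.
  by move=> [[/= aM Ma]|[/= aM Ma]]; split => /=; lra.
have dis : slice a (dl * n%:R) `&` slice (a + dl * n%:R) dl `<=` set0.
  by move=> w [[_ /= Ma] [/= aM _]]; move: Ma; rewrite ltNge aM.
rewrite cut setIUl !fine_prob_setU//.
- by rewrite !mulrDr lerD// moved_slice.
- exact/disj_setPS.
- exact: measurableI.
- exact: measurableI.
- by apply/disj_setPS => w [[s1 _] [s2 _]]; exact: (dis w).
Qed.

Let moved_null eta K : 0 < eta -> 0 <= K ->
  P (slice (- K) (2 * K) `&` moved eta) = 0.
Proof.
move=> eta0 K0; set E := _ `&` _.
have mE : measurable E by apply: measurableI.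
rewrite -[LHS]fineK ?fin_num_measure//; congr (_%:E); set x := fine _.
have x0 : 0 <= x by rewrite fine_ge0.
have x1 : x <= 1 by rewrite -lee_fin fineK ?fin_num_measure// probability_le1.
apply/le_anti; rewrite x0 andbT leNgt; apply/negP => x0'.
(* n slices, so many that dl < eta * x / 2, which contradicts moved_slices *)
pose n := (Num.truncn (4 * K / (eta * x))).+1.
have n0 : 0 < n%:R :> R by rewrite ltr0n.
pose dl := 2 * K / n%:R.
have ex0 : 0 < eta * x by rewrite mulr_gt0.
have dl0 : 0 <= dl by rewrite divr_ge0// mulr_ge0.
have dlx : dl < eta * x / 2.
  have : 4 * K / (eta * x) < n%:R by rewrite truncnS_gt.
  rewrite ltr_pdivrMr// => Kn; rewrite ltr_pdivrMr//; lra.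
have exe : eta * x <= eta by rewrite ler_piMr// ltW.
have dle : dl <= eta / 2 by lra.
have := moved_slices (- K) dl eta n.
have -> : dl * n%:R = 2 * K by rewrite /dl divfK// gt_eqF.
rewrite -/E -/x => /(_ ltac:(by rewrite dl0/=; lra)).
have s1 : fine (P (slice (- K) (2 * K))) <= 1.
  by rewrite -lee_fin fineK ?fin_num_measure// probability_le1.
move=> main; have {main}: (eta - dl) ^+ 2 * x <= dl ^+ 2.
  by apply: le_trans main _; rewrite ler_piMr// sqr_ge0.
apply/negP; rewrite -ltNge.
apply: (@lt_le_trans _ _ ((eta * x / 2) ^+ 2)).
  by rewrite ltr_pXn2r// nnegrE ltW// divr_gt0.
apply: (@le_trans _ _ ((eta / 2) ^+ 2 * x)).
  have -> : (eta * x / 2) ^+ 2 = (eta / 2) ^+ 2 * x * x by field.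
  by rewrite ler_piMr// mulr_ge0// sqr_ge0.
by rewrite ler_wpM2r// ler_pXn2r ?nnegrE//; lra.
Qed.

Lemma flat_moved_negligible K eta : 0 < eta -> 0 <= K ->
  P.-negligible [set w | [/\ A q w = A r w, (r%:E < S1 w)%E, (r%:E < S2 w)%E,
    `|A q w| <= L & - K <= M q w < K] /\ eta <= `|M r w - M q w| ].
Proof.
move=> eta0 K0; exists (slice (- K) (2 * K) `&` moved eta); split.
- exact: measurableI.
- exact: moved_null.
- move=> w /= [[Aqr rS1 rS2 AL /andP[KM MK]] etaM].
  by do !split => //=; rewrite ?Aqr//; lra.
Qed.

End flat.

(** For two fixed times this is a countable union of negligible events, since the
    localizing times tend to infinity; countably many pairs of rational times
    then suffice by continuity of [M], as [A] is constant between two times at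
    which it has the same value. *)
Lemma local_martingale_flat d (T : measurableType d) (R : realType)
    (P : probability T R) (F : R -> set_system T) (M A : R -> T -> R) :
  filtration F -> local_martingale P F M -> continuous_paths P M ->
  quadratic_variation P F M A ->
  {ae P, forall w, forall s t, 0 <= s -> s <= t -> A s w = A t w ->
    M s w = M t w}.
Proof.
move=> FF [Mad [S1 [S1F _ S1oo Xm]]] Mc [Aad Ac A_homo _ [_ [S2 [S2F _ S2oo Zm]]]].
have rational (q r : R) : 0 <= q <= r -> {ae P, forall w, A q w = A r w -> M q w = M r w}.
  move=> qr.
  pose N n := [set w | [/\ A q w = A r w, (r%:E < S1 n w)%E, (r%:E < S2 n w)%E,
    `|A q w| <= n%:R & - n%:R <= M q w < n%:R] /\ n.+1%:R^-1 <= `|M r w - M q w| ].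
  have : P.-negligible (\bigcup_n N n).
    apply: negligible_bigcup => n.
    by apply: (flat_moved_negligible _ _ _ P F) => //; rewrite invr_gt0.
  move=> Nn; have {}Nn : {ae P, forall w, ~ (\bigcup_n N n) w}.
    by apply: negligibleS Nn => w /= /contrapT.
  apply: filterS3 S1oo S2oo Nn => w S1w S2w Nw Aqr.
  apply/eqP; rewrite eq_sym -subr_eq0; apply/negPn/negP; rewrite -normr_gt0 => Mqr.
  apply: Nw; near \oo => n; exists n => //; split; first split => //.
  - near: n; by apply: (cvgey_gtr S1w); exact: num_real.
  - near: n; by apply: (cvgey_gtr S2w); exact: num_real.
  - by apply/ltW; near: n; exact: nbhs_infty_gtr.
  - rewrite lerNl.
    have : `|M q w| < n%:R by near: n; exact: nbhs_infty_gtr.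
    by rewrite ltr_norml ltrNl => /andP[/ltW -> ->].
  - rewrite invf_ple ?posrE// ltW//; apply: (@lt_trans _ _ n%:R); last by rewrite ltr_nat.
    near: n; exact: nbhs_infty_gtr.
have allrat : {ae P, forall w, forall k : rat * rat,
    0 <= (ratr k.1 : R) <= ratr k.2 -> A (ratr k.1) w = A (ratr k.2) w ->
    M (ratr k.1) w = M (ratr k.2) w}.
  suff : {ae P, forall w, forall (n : nat) (k : rat * rat),
      choice.unpickle n = Some k ->
      0 <= (ratr k.1 : R) <= ratr k.2 -> A (ratr k.1) w = A (ratr k.2) w ->
      M (ratr k.1) w = M (ratr k.2) w}.
    by apply: filterS => w Hw k; apply: (Hw (choice.pickle k)); rewrite choice.pickleK.
  apply/ae_foralln => n; case: choice.unpickle => [k|]; last exact: aeW.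
  have [k0|k0] := boolP (0 <= (ratr k.1 : R) <= ratr k.2); last by apply: aeW => w _ [<-]; rewrite (negbTE k0).
  by apply: filterS (rational _ _ k0) => w Hw _ [<-].
move: allrat Mc A_homo; apply: filterS3 => w rat_w Mw Aw s t s0 + Ast.
rewrite le_eqVlt => /predU1P[->//|st].
apply/eqP; rewrite -subr_eq0 -normr_le0; apply/ler_addgt0Pr => e e0; rewrite add0r.
have e2 : 0 < e / 2 by rewrite divr_gt0.
have t0 := le_trans s0 (ltW st).
have [d1 d10 Md1] := halfline_continuous_dist _ _ Mw _ _ s0 e2.
have [d2 d20 Md2] := halfline_continuous_dist _ _ Mw _ _ t0 e2.
have [|u] := @rat_in_itvoo R s (Order.min t (s + d1)).
  by rewrite lt_min st ltrDl.
rewrite in_itv/= lt_min => /and3P[su ut ud].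
have [|v] := @rat_in_itvoo R (Order.max (ratr u) (t - d2)) t.
  by rewrite gt_max ut/= ltrBlDr ltrDl.
rewrite in_itv/= gt_max => /andP[/andP[uv dv] vt].
have u0 : 0 <= ratr u :> R by exact: le_trans s0 (ltW su).
have v0 : 0 <= ratr v :> R by exact: le_trans u0 (ltW uv).
have Auv : A (ratr u) w = A (ratr v) w.
  apply/le_anti; rewrite Aw// ?(ltW uv)//=.
  apply: (@le_trans _ _ (A t w)); first by apply: Aw => //; exact: ltW.
  by rewrite -Ast; apply: Aw => //; exact: ltW.
have := rat_w (u, v); rewrite u0 (ltW uv) => /(_ isT Auv)/= Muv.
have := Md1 (ratr u) u0; rewrite ger0_norm; last by lra.
move=> /(_ ltac:(lra)) Mu.
have := Md2 (ratr v) v0; rewrite ler0_norm; last by lra.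
move=> /(_ ltac:(lra)) Mv.
have -> : M s w - M t w = (M (ratr v) w - M t w) - (M (ratr u) w - M s w).
  by rewrite Muv; ring.
apply: le_trans (ler_normB _ _) _; lra.
Unshelve. all: by end_near. Qed.

(** * The approximation error *)

Lemma ae_enlargement d (T : measurableType d) d' (T' : measurableType d')
    (R : realType) (P : probability T R) (P' : probability T' R) (p : T' -> T)
    (Q : T -> Prop) :
  enlargement P P' p -> {ae P, forall w, Q w} -> {ae P', forall w, Q (p w)}.
Proof.
move=> [mp Pp] [B [mB B0 QB]]; exists (p @^-1` B); split.
- by rewrite -[X in measurable X]setTI; exact: mp.
- by rewrite -B0; exact: Pp.
- by move=> w /= nQ; apply: QB.
Qed.

(** The null sets of the original space are pulled back to the enlargement; the
    alternative for the auxiliary process is what the pathwise bound needs, since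
    that process is only read at time [0], on paths with a finite total
    variation of [A]. *)
Lemma approx_error_le_ae (R : realType) (d : measure_display)
    (T : measurableType d) (P : probability T R) (F : R -> set_system T)
    (M A : R -> T -> R) (d' : measure_display) (T' : measurableType d')
    (P' : probability T' R) (p : T' -> T) (beta : R -> T' -> R) :
  filtration F -> local_martingale P F M -> continuous_paths P M ->
  quadratic_variation P F M A -> dds_enlargement P M A P' p beta ->
  {ae P', forall w, forall m K,
    (approx_error M A p beta m K w <= (2 ^- m)%:E)%E}.
Proof.
move=> FF Mlm Mc MA [Pp binit].
have transport Q : {ae P, forall w, Q w} -> {ae P', forall w, Q (p w)}.
  exact: ae_enlargement.
have [_ Ac A_homo A0 _] := MA.
have binit0 : {ae P', forall w, qv_infty A (p w) = +oo%E \/ beta 0 w = 0}.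
  case: binit => [Aoo|[[_ b0 _ _ _] _]].
    by apply: filterS (transport _ Aoo) => w; left.
  by apply: filterS b0 => w; right.
near=> w => m K; apply: approx_error_le; near: w.
- exact: transport _ Mc.
- exact: transport _ Ac.
- exact: transport _ A_homo.
- exact: transport _ A0.
- exact: transport _ (local_martingale_flat _ _ _ _ _ _ _ FF Mlm Mc MA).
- exact: binit0.
Unshelve. all: by end_near. Qed.

Theorem theorem4 (R : realType) :
  (forall (d : measure_display) (T : measurableType d) (P : probability T R)
      (F : R -> set_system T) (M A : R -> T -> R)
      (d' : measure_display) (T' : measurableType d') (P' : probability T' R)
      (p : T' -> T) (beta : R -> T' -> R),
    filtration F ->
    local_martingale P F M -> continuous_paths P M -> vanishes_at_0 P M ->
    quadratic_variation P F M A ->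
    dds_enlargement P M A P' p beta ->
    forall (K : R) (c : nat -> R),
      0 < K ->
      (forall m n : nat, (m <= n)%N -> c m <= c n) ->
      c m @[m --> \oo] --> +oo ->
      {ae P', forall w, \forall m \near \oo,
        (approx_error M A p beta m K w
           < (c m * m%:R * 2 `^ (- (m%:R / 2)))%:E)%E})
  /\
  (exists m5 : nat, (0 < m5)%N /\
    forall (d : measure_display) (T : measurableType d) (P : probability T R)
      (F : R -> set_system T) (M A : R -> T -> R)
      (d' : measure_display) (T' : measurableType d') (P' : probability T' R)
      (p : T' -> T) (beta : R -> T' -> R),
    filtration F ->
    local_martingale P F M -> continuous_paths P M -> vanishes_at_0 P M ->
    quadratic_variation P F M A ->
    dds_enlargement P M A P' p beta ->
    forall g : R -> R,
      (forall t : R, 0 < t -> Order.max t (expR 1) <= g t) ->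
      (forall t : R, 0 < t -> {ae P, forall w, A t w <= g t}) ->
      forall m : nat, (m5 <= m)%N ->
        {ae P', forall w, \forall K \near +oo,
          (approx_error M A p beta m K w
             < (g K `^ (1 / 4) * ln (g K) `^ (3 / 4))%:E)%E}).
Proof.
split.
  move=> d T P F M A d' T' P' p beta FF Mlm Mc _ MA PP' K c _ _ coo.
  apply: filterS (approx_error_le_ae _ _ _ _ _ _ _ _ _ _ _ _ FF Mlm Mc MA PP') => w err.
  near=> m; apply: le_lt_trans (err m K) _; rewrite lte_fin.
  have c1 : 1 < c m by near: m; apply: (cvgry_gtr coo); exact: num_real.
  have m0 : (0 < m)%N by near: m; exact: nbhs_infty_gt.
  have m1 : 1 <= m%:R :> R by rewrite ler1n.
  apply: (@le_lt_trans _ _ (2 `^ (- (m%:R / 2)))).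
    by rewrite -powR_invn// ler_powR ?ler1n//; lra.
  rewrite ltr_pMl ?powR_gt0//; apply: (lt_le_trans c1).
  by rewrite ler_peMr// ltW// (lt_trans _ c1).
exists 1%N; split=> // d T P F M A d' T' P' p beta FF Mlm Mc _ MA PP' g ge _ m m1.
apply: filterS (approx_error_le_ae _ _ _ _ _ _ _ _ _ _ _ _ FF Mlm Mc MA PP') => w err.
near=> K; apply: le_lt_trans (err m K) _; rewrite lte_fin.
have K0 : 0 < K by near: K; apply: nbhs_pinfty_gt; exact: num_real.
have gK : expR 1 <= g K by apply: le_trans (ge K K0); rewrite le_max lexx orbT.
have g1 : 1 <= g K by apply: le_trans gK; rewrite -expR0 ler_expR.
have lng1 : 1 <= ln (g K).
  by rewrite -[leLHS]expRK ler_ln// posrE ?expR_gt0// (lt_le_trans _ g1).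
have powR_ge1 (x r : R) : 0 <= r -> 1 <= x -> 1 <= x `^ r.
  move=> r0 x1; apply: (@le_trans _ _ (1 `^ r)); first by rewrite powR1.
  by apply: ge0_ler_powR => //; rewrite nnegrE// (le_trans _ x1).
apply: (@lt_le_trans _ _ 1).
  by rewrite invf_lt1 ?exprn_gt0// exprn_egt1 ?ltr1n// -lt0n.
by rewrite -[leLHS]mulr1 ler_pM// powR_ge1.
Unshelve. all: by end_near. Qed.
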